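(* Let $S$ be the set containing 4 copies of each odd positive integer, 6 copies of each positive multiple of 4, and 10 copies of each positive integer congruent to 2 modulo 4; let $T$ be the set containing 4 copies of each odd positive integer, 10 copies of each positive multiple of 4, and 6 copies of each positive integer congruent to 2 modulo 4. Let $D_S(N)$ (respectively, $D_T(N)$) be the number of partitions of $N$ into distinct elements of $S$ (respectively, $T$). Then, for every integer $N\geq 1$, $$D_S(N)=4\,D_T(N-1).$$
   Context: A ''set containing several copies'' of certain integers means a set of colored integers: the different copies of the same integer are regarded as distinct (distinguishable) elements, each having that integer as its value. A partition of $N$ into distinct elements of $X$ is a finite subset of $X$ whose elements have values summing to $N$ (so each copy is used at most once, but different copies of the same integer may be used together, and subsets using different copies are counted as different). The empty partition is the unique partition of $0$. No restriction is imposed on the number of parts. *)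

(* Defs.v *)
From mathcomp Require Import all_boot finmap.

Set Implicit Arguments.
Unset Strict Implicit.
Unset Printing Implicit Defensive.

Local Open Scope fset_scope.

(* The set containing m n copies of each positive integer n, the pair (n, c)
   being the copy of colour c, for c = 0, ..., m n - 1; m 0 is irrelevant. *)
Definition copies (m : nat -> nat) : pred (nat * nat) :=
  [pred x : nat * nat | (0 < x.1) && (x.2 < m x.1)].

Definition is_distinct_partition (m : nat -> nat) (N : nat)
    (A : {fset nat * nat}) : bool :=
  all (copies m) A && (\sum_(x <- A) x.1 == N).

(* The elements of copies m of value at most N. By mem_distinct_partitions
   below, restricting to them loses no partition of N. *)
Definition copies_upto (m : nat -> nat) (N : nat) : {fset nat * nat} :=
  seq_fset tt [seq (n, c) | n <- iota 1 N, c <- iota 0 (m n)].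

Definition distinct_partitions (m : nat -> nat) (N : nat) :
    {fset {fset nat * nat}} :=
  [fset A in fpowerset (copies_upto m N) | is_distinct_partition m N A].

Lemma mem_copies_upto (m : nat -> nat) (N : nat) (x : nat * nat) :
  (x \in copies_upto m N) = copies m x && (x.1 <= N).
Proof.
case: x => n c; rewrite seq_fsetE /=.
apply/allpairsPdep/idP => [[n' [c' []]]|].
  rewrite !mem_iota /= => /andP[n0 nN] cm [-> ->].
  by rewrite /copies /= n0 cm -ltnS.
case/andP=> /andP[n0 cm] nN; exists n, c.
by rewrite !mem_iota add0n add1n ltnS n0 nN cm.
Qed.

Lemma mem_distinct_partitions (m : nat -> nat) (N : nat)
    (A : {fset nat * nat}) :
  (A \in distinct_partitions m N) = is_distinct_partition m N A.
Proof.
rewrite !inE /= fpowersetE; apply: andb_idl => /andP[/allP Am /eqP sumA].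
apply/fsubsetP => x xA; rewrite mem_copies_upto Am //= -sumA.
by rewrite (big_rem x) //= leq_addr.
Qed.

Definition D (m : nat -> nat) (N : nat) : nat := #|` distinct_partitions m N|.

Definition mult_S (n : nat) : nat :=
  if odd n then 4 else if 4 %| n then 6 else 10.

Definition mult_T (n : nat) : nat :=
  if odd n then 4 else if 4 %| n then 10 else 6.

Definition D_S (N : nat) : nat := D mult_S N.
Definition D_T (N : nat) : nat := D mult_T N.

(* Main.v *)
Require Import Defs.
From mathcomp Require Import all_boot all_algebra finmap ring zify.

(** The generating function of [D_S] is the product of the factors
    [(1 + q ^ n) ^ mult_S n], and likewise for [D_T], so the theorem amounts
    to [F_S = 1 + 4 q F_T].  Since [S] and [T] differ only in their even
    members, the two series share the factor
    [C = prod_(n odd) (1 + q ^ n) ^ 4 * prod_(n even) (1 + q ^ n) ^ 6], and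
    [F_S - 4 q F_T = C * (B2 ^ 4 - 4 q B4 ^ 4)], where [B2] and [B4] are the
    products of [1 + q ^ n] over [n = 2 mod 4] and over [n = 0 mod 4].

    The bracket is evaluated with theta functions.  Put [q = s ^ 2], and let
    [phi x] be the sum of [x ^ (k ^ 2)] over all integers [k].  Separating the
    even [k] from the odd [k] gives [phi (+-s) = U +- s V], with [U] the sum of
    [s ^ (4 k ^ 2)] and [V] the sum of [s ^ (4 k (k + 1))] ([theta_dissect]),
    hence [phi s * phi (- s) = U ^ 2 - q V ^ 2].  The Jacobi triple product
    turns the four theta functions into infinite products
    ([theta_product]); with [E4] the product of the [1 - q ^ (4 n)] one has
    [U = E4 * B2 ^ 2] and [V = 2 * E4 * B4 ^ 2], while [phi s * phi (- s)] is
    the square of a product in [q] alone.  This is [theta_product_sqr], an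
    evaluation of [E4 ^ 2 * (B2 ^ 4 - 4 q B4 ^ 4)].  Multiplying by [C],
    everything collapses to [E4 ^ 2] by repeated use of
    [(1 - x) (1 + x) = 1 - x ^ 2] ([gen_copies_ST]).

    Infinite products and series are made finite by working in a commutative
    ring where [s] is nilpotent: there every product below is eventually
    constant in its number of factors, every theta series has finitely many
    nonzero terms, and the products of factors [1 - q ^ n] can be cancelled.
    Taking this ring to be [Z[X] / X ^ K] with [s = X] and [K] large, the
    identity is read off on the coefficient of [X ^ (2 N)]. *)

Set Implicit Arguments.
Unset Strict Implicit.
Unset Printing Implicit Defensive.

Import GRing.Theory.
Local Open Scope ring_scope.

(** * * Finite products and sums *)

Lemma prod_double (R : comNzRingType) (F : nat -> R) L :
  \prod_(i < 2 * L) F i =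
  (\prod_(i < L) F (2 * i)%N) * \prod_(i < L) F (2 * i).+1.
Proof.
elim: L => [|L IH]; first by rewrite !big_ord0 mulr1.
by rewrite mulnS !addSn add0n !big_ord_recr /= IH; ring.
Qed.

Lemma sum_double (R : comNzRingType) (F : nat -> R) L :
  \sum_(i < 2 * L) F i = (\sum_(i < L) F (2 * i)%N) + \sum_(i < L) F (2 * i).+1.
Proof.
elim: L => [|L IH]; first by rewrite !big_ord0 addr0.
by rewrite mulnS !addSn add0n !big_ord_recr /= IH; ring.
Qed.

Lemma nilp_ge (R : comNzRingType) (p : R) K n :
  p ^+ K = 0 -> (K <= n)%N -> p ^+ n = 0.
Proof. by move=> pK Kn; rewrite -(subnKC Kn) exprD pK mul0r. Qed.

Lemma prod_stable (R : comNzRingType) (F : nat -> R) L M :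
  (L <= M)%N -> (forall i, (L <= i)%N -> F i = 1) ->
  \prod_(i < M) F i = \prod_(i < L) F i.
Proof.
move=> LM F1; rewrite -(subnKC LM) big_split_ord /= [X in _ * X]big1 ?mulr1 //.
by move=> i _; rewrite F1 ?leq_addr.
Qed.

(** * * Gaussian binomial coefficients *)

(** The Gaussian binomial coefficient, that is the binomial coefficient ['C(n, k)]
    deformed by the variable [p]. *)
Fixpoint gauss (R : comNzRingType) (p : R) (n k : nat) : R :=
  match n, k with
  | _, 0%N => 1
  | 0%N, _.+1 => 0
  | n'.+1, k'.+1 => gauss p n' k' + p ^+ k * gauss p n' k
  end.

Arguments gauss : simpl never.

Lemma gauss0 (R : comNzRingType) (p : R) n : gauss p n 0 = 1.
Proof. by case: n. Qed.

Lemma gaussS (R : comNzRingType) (p : R) n k :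
  gauss p n.+1 k.+1 = gauss p n k + p ^+ k.+1 * gauss p n k.+1.
Proof. by []. Qed.

Lemma gauss_gt (R : comNzRingType) (p : R) n k : (n < k)%N -> gauss p n k = 0.
Proof.
elim: n k => [|n IH] [|k] //= nk.
by rewrite gaussS !IH ?mulr0 ?addr0 // ltnW.
Qed.

(** The companion of the defining recursion [gaussS], with the power of [p] on
    the other term.  The triple product needs both, one for each of its two
    families of factors.
    For [n < k] both sides vanish, so the truncated [n - k] is harmless. *)
Lemma gauss_pascal (R : comNzRingType) (p : R) n k :
  gauss p n.+1 k.+1 = p ^+ (n - k) * gauss p n k + gauss p n k.+1.
Proof.
elim: n k => [|n IH] k.
  by rewrite sub0n mul1r gaussS [gauss p 0 k.+1]gauss_gt // mulr0.
rewrite gaussS; case: k => [|k].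
  by rewrite [in RHS]gaussS IH !subn0 !gauss0 [p ^+ n.+1]exprS; ring.
have [nk|kn] := leqP n k.
  rewrite [gauss p n.+1 k.+2]gauss_gt ?ltnS // mulr0 addr0.
  by rewrite (_ : n.+1 - k.+1 = 0)%N ?mul1r ?addr0 //; lia.
rewrite [in RHS]gaussS [gauss p n.+1 k.+2 in RHS]gaussS !IH subSS.
have e : p ^+ k.+2 * p ^+ (n - k.+1) = p ^+ (n - k) * p ^+ k.+1.
  by rewrite -!exprD; congr (_ ^+ _); lia.
rewrite [p ^+ k.+2 * (_ + _)]mulrDr [p ^+ k.+2 * (_ * _)]mulrA e; ring.
Qed.

(** The finite q-Pochhammer product, usually written [(p; p)_n]. *)
Definition poch (R : comNzRingType) (p : R) (n : nat) : R :=
  \prod_(i < n) (1 - p ^+ i.+1).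

Lemma poch0 (R : comNzRingType) (p : R) : poch p 0 = 1.
Proof. by rewrite /poch big_ord0. Qed.

Lemma pochS (R : comNzRingType) (p : R) n :
  poch p n.+1 = poch p n * (1 - p ^+ n.+1).
Proof. by rewrite /poch big_ord_recr. Qed.

(** The Gaussian binomial as the quotient [(p)_(j+k) / ((p)_j (p)_k)], without
    dividing. *)
Lemma poch_gauss (R : comNzRingType) (p : R) j k :
  gauss p (j + k) j * (poch p j * poch p k) = poch p (j + k).
Proof.
have [N] := ubnP (j + k); elim: N j k => // N IH [|j] [|k] jkN.
- by rewrite gauss0 poch0 !mul1r.
- by rewrite gauss0 poch0 add0n !mul1r.
- have := IH j 0%N jkN; rewrite !addn0 poch0 !mulr1 gaussS => E.
  by rewrite [gauss p j j.+1]gauss_gt // mulr0 addr0 pochS mulrA E.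
have E1 := IH j k.+1 ltac:(lia); have E2 := IH j.+1 k ltac:(lia).
rewrite addnS in E1; rewrite addSn in E2; rewrite addSn addnS.
rewrite gaussS [in RHS]pochS.
have -> : p ^+ (j + k).+2 = p ^+ j.+1 * p ^+ k.+1.
  by rewrite -exprD; congr (_ ^+ _); lia.
transitivity (gauss p (j + k).+1 j * (poch p j * poch p k.+1) * (1 - p ^+ j.+1)
  + gauss p (j + k).+1 j.+1 * (poch p j.+1 * poch p k)
    * (p ^+ j.+1 * (1 - p ^+ k.+1))).
  rewrite !pochS; ring.
rewrite E1 E2; ring.
Qed.

Lemma poch_stable (R : comNzRingType) (p : R) K L :
  p ^+ K = 0 -> (K <= L)%N -> poch p L = poch p K.
Proof.
move=> pK KL; apply: (@prod_stable _ (fun i => 1 - p ^+ i.+1)) => // i Ki.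
by rewrite (nilp_ge pK) ?subr0 // ltnW.
Qed.

(** A factor [1 - x] with [x] nilpotent is inverted by the geometric sum. *)
Lemma lreg_poch (R : comNzRingType) (p : R) K n :
  p ^+ K = 0 -> GRing.lreg (poch p n).
Proof.
move=> pK; elim: n => [|n IH]; first by rewrite poch0; exact: lreg1.
rewrite pochS; apply: lregM => //.
have qK : (p ^+ n.+1) ^+ K = 0 by rewrite exprAC pK expr0n.
move: (p ^+ n.+1) qK => q qK x y /(congr1 (fun z => (\sum_(i < K) q ^+ i) * z)).
have e : (\sum_(i < K) q ^+ i) * (1 - q) = 1.
  by rewrite mulrC -opprB mulNr -subrX1 qK sub0r opprK.
by rewrite !mulrA e !mul1r.
Qed.

Lemma poch_prod1D (R : comNzRingType) (p : R) n :
  poch p n * \prod_(i < n) (1 + p ^+ i.+1) = poch (p ^+ 2) n.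
Proof.
rewrite /poch -big_split; apply: eq_bigr => i _ /=.
rewrite -exprM mulnC exprM; ring.
Qed.

(** * * The Jacobi triple product *)

(** The term of index [k = j - m] of Ramanujan's theta series [f(a, b)], that is
    [a ^ (k (k + 1) / 2) * b ^ (k (k - 1) / 2)].  The index [k] ranges over the
    integers from [- m] on; of the truncated differences [j - m] and [m - j]
    one vanishes and the other is the absolute value of [k]. *)
Definition theta_term (R : comNzRingType) (a b : R) (m j : nat) : R :=
  a ^+ ('C((j - m).+1, 2) + 'C(m - j, 2))
  * b ^+ ('C(j - m, 2) + 'C((m - j).+1, 2)).

Definition theta (R : comNzRingType) (a b : R) (m : nat) : R :=
  \sum_(j < (2 * m).+1) theta_term a b m j.

Lemma theta_termS (R : comNzRingType) (a b : R) m j :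
  theta_term a b m.+1 j.+1 = theta_term a b m j.
Proof. by rewrite /theta_term !subSS. Qed.

(** How a new factor of the triple product shifts the theta terms: multiplication
    by [a] raises the index [k = j - m] by one and multiplication by [b] lowers
    it by one, up to powers of [a * b], and these are the powers that occur in
    [sum_gaussl] and [sum_gaussr]. *)
Lemma theta_term_stepl (R : comNzRingType) (a b : R) n m j : (j <= n + m)%N ->
  a * (a * b) ^+ n * theta_term a b m j =
  (a * b) ^+ (n + m - j) * theta_term a b m j.+1.
Proof.
move=> jnm; rewrite /theta_term.
have [mj|jm] := leqP m j.
  have -> : (m - j = 0)%N by lia.
  have -> : (m - j.+1 = 0)%N by lia.
  have [d dE] : exists d, (j - m = d)%N by exists (j - m)%N.
  rewrite dE (_ : j.+1 - m = d.+1)%N; last by lia.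
  have [e ->] : exists e, n = (d + e)%N by exists (n - d)%N; lia.
  rewrite (_ : d + e + m - j = e)%N; last by lia.
  rewrite !binS !bin1 !bin0 !exprMn !exprD; ring.
have -> : (j - m = 0)%N by lia.
have -> : (j.+1 - m = 0)%N by lia.
have [d dE] : exists d, (m - j = d.+1)%N by exists (m - j).-1; lia.
rewrite dE (_ : m - j.+1 = d)%N; last by lia.
rewrite (_ : n + m - j = n + d.+1)%N; last by lia.
rewrite !binS !bin1 !bin0 !exprMn ?addn0 ?add0n !exprD !exprS; ring.
Qed.

Lemma theta_term_stepr (R : comNzRingType) (a b : R) m j : (j <= m)%N ->
  b * (a * b) ^+ m * theta_term a b m j =
  (a * b) ^+ j * theta_term a b m.+1 j.
Proof.
move=> jm; rewrite /theta_term.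
have -> : (j - m = 0)%N by lia.
have -> : (j - m.+1 = 0)%N by lia.
have [d ->] : exists d, m = (j + d)%N by exists (m - j)%N; lia.
have -> : (j + d - j = d)%N by lia.
have -> : ((j + d).+1 - j = d.+1)%N by lia.
rewrite !binS !bin1 !bin0 !exprMn ?addn0 ?add0n !exprD !exprS; ring.
Qed.

Lemma sum_gaussl (R : comNzRingType) (p : R) (t : nat -> R) n :
  \sum_(j < n.+2) gauss p n.+1 j * t j =
  \sum_(j < n.+1) gauss p n j * (t j + p ^+ (n - j) * t j.+1).
Proof.
rewrite big_ord_recl.
under eq_bigr => j _ do rewrite lift0 gauss_pascal mulrDl.
rewrite big_split /= [in RHS](eq_bigr (fun j : 'I_n.+1 => gauss p n j * t j +
  p ^+ (n - j) * gauss p n j * t j.+1)); last by move=> j _; ring.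
rewrite [RHS]big_split /= [in RHS]addrC addrCA; congr (_ + _).
rewrite [X in _ + X = _]big_ord_recr /= [gauss p n n.+1]gauss_gt // mul0r addr0.
by rewrite [RHS]big_ord_recl /= !gauss0.
Qed.

Lemma sum_gaussr (R : comNzRingType) (p : R) (t : nat -> R) n :
  \sum_(j < n.+2) gauss p n.+1 j * t j =
  \sum_(j < n.+1) gauss p n j * (p ^+ j * t j + t j.+1).
Proof.
rewrite big_ord_recl.
under eq_bigr => j _ do rewrite lift0 gaussS mulrDl.
rewrite big_split /= [in RHS](eq_bigr (fun j : 'I_n.+1 =>
  p ^+ j * gauss p n j * t j + gauss p n j * t j.+1)); last by move=> j _; ring.
rewrite [RHS]big_split /= [in RHS]addrC addrCA; congr (_ + _).
rewrite [X in _ + X = _]big_ord_recr /= [gauss p n n.+1]gauss_gt // mulr0 mul0r addr0.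
by rewrite [RHS]big_ord_recl /= !gauss0 mulr1.
Qed.

(** Induction on the number of factors of each kind: a new factor in [b] is
    absorbed by the defining recursion of [gauss], a new factor in [a] by the
    other one. *)
Lemma finite_jacobi_triple (R : comNzRingType) (a b : R) n m :
  (\prod_(i < n) (1 + a * (a * b) ^+ i)) *
  (\prod_(i < m) (1 + b * (a * b) ^+ i)) =
  \sum_(j < (n + m).+1) gauss (a * b) (n + m) j * theta_term a b m j.
Proof.
elim: n => [|n IH].
  rewrite big_ord0 mul1r add0n; elim: m => [|m IH].
    by rewrite big_ord0 big_ord1 /= /theta_term !mul1r.
  rewrite big_ord_recr /= IH sum_gaussr mulr_suml; apply: eq_bigr => j _.
  rewrite -(@theta_term_stepr _ a b m j) -1?ltnS // theta_termS; ring.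
rewrite big_ord_recr /= mulrAC IH addSn sum_gaussl mulr_suml.
apply: eq_bigr => j _.
rewrite -(@theta_term_stepl _ a b n m j) -1?ltnS //; ring.
Qed.

(** When [a * b] is nilpotent the Gaussian binomials near the middle of the row,
    multiplied by [poch (a * b) n], are equal to 1, all the Pochhammer products
    in [poch_gauss] having reached their common limit.  The hypothesis says
    that the terms away from the middle vanish by themselves. *)
Lemma jacobi_triple_nilp (R : comNzRingType) (a b : R) K n :
  (a * b) ^+ K = 0 ->
  (forall j, (j <= 2 * n)%N ->
     theta_term a b n j = 0 \/ (K <= j)%N && (K <= 2 * n - j)%N) ->
  poch (a * b) n * (\prod_(i < n) (1 + a * (a * b) ^+ i)) *
    (\prod_(i < n) (1 + b * (a * b) ^+ i)) = theta a b n.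
Proof.
set p := a * b => pK tn.
have st L : (K <= L)%N -> poch p L = poch p K by exact: poch_stable.
rewrite -mulrA finite_jacobi_triple addnn -mul2n mulr_sumr; apply: eq_bigr => j _.
have jn : (j <= 2 * n)%N by rewrite -ltnS.
case: (tn j jn) => [->|/andP[Kj Kn]]; first by rewrite !mulr0.
rewrite mulrA; suff -> : poch p n * gauss p (2 * n) j = 1 by rewrite mul1r.
have := poch_gauss p j (2 * n - j); rewrite subnKC //.
rewrite !st //; try lia; move=> E.
by apply: (@lreg_poch _ p K K pK); rewrite mulr1 -[RHS]E; ring.
Qed.

(** * * Theta functions at plus and minus s *)

Lemma bin2_sqr d : ('C(d.+1, 2) + 'C(d, 2) = d ^ 2)%N.
Proof.
elim: d => // d IH; move: IH; rewrite [in RHS]expnS expn1.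
by have := binS d 1; have := binS d.+1 1; rewrite !bin1 -mulnn; lia.
Qed.

Lemma theta_term_diag (R : comNzRingType) (x : R) m j :
  theta_term x x m j = x ^+ ((j - m) ^ 2 + (m - j) ^ 2).
Proof. by rewrite /theta_term -exprD -!bin2_sqr; congr (_ ^+ _); lia. Qed.

(** Separate the indices [k] of the theta series [sum_k x ^ (k ^ 2)] by parity:
    [(2 k) ^ 2 = 4 k ^ 2] and [(2 k + 1) ^ 2 = 8 (k (k + 1) / 2) + 1]. *)
Lemma theta_dissect (R : comNzRingType) (x : R) m :
  theta x x (2 * m) =
  theta (x ^+ 4) (x ^+ 4) m + x * \sum_(j < 2 * m) theta_term (x ^+ 8) 1 m j.
Proof.
rewrite /theta !big_ord_recr /= sum_double mulr_sumr [RHS]addrAC; congr (_ + _ + _).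
- apply: eq_bigr => i _; rewrite !theta_term_diag -exprM -!mulnBr !expnMn.
  by congr (_ ^+ _); lia.
- apply: eq_bigr => i _; rewrite theta_term_diag /theta_term expr1n mulr1.
  rewrite -exprM -exprS; congr (_ ^+ _).
  move: (nat_of_ord i) => {}i; have [mi|im] := leqP m i.
    have [d ->] : exists d, i = (m + d)%N by exists (i - m)%N; lia.
    have := bin2_sqr d; have := binS d 1; rewrite bin1.
    have -> : ((2 * (m + d)).+1 - 2 * m = (2 * d).+1)%N by lia.
    have -> : (m + d - m = d)%N by lia.
    have -> : (m - (m + d) = 0)%N by lia.
    have -> : (2 * m - (2 * (m + d)).+1 = 0)%N by lia.
    rewrite bin0n /= -!mulnn; nia.
  have [d ->] : exists d, m = (i + d.+1)%N by exists (m - i).-1%N; lia.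
  have := bin2_sqr d; have := binS d 1; rewrite bin1.
  have -> : ((2 * i).+1 - 2 * (i + d.+1) = 0)%N by lia.
  have -> : (i - (i + d.+1) = 0)%N by lia.
  have -> : (i + d.+1 - i = d.+1)%N by lia.
  have -> : (2 * (i + d.+1) - (2 * i).+1 = (2 * d).+1)%N by lia.
  rewrite (_ : 'C(1, 2) = 0)%N // -!mulnn; nia.
- rewrite !theta_term_diag -exprM -!mulnBr !expnMn.
  by congr (_ ^+ _); lia.
Qed.

(** The odd part of the dissection lacks the last term of [theta y 1 m], which is
    [y ^ (m (m + 1) / 2)] and vanishes for large [m]. *)
Lemma theta_odd_nilp (R : comNzRingType) (y : R) K m :
  y ^+ K = 0 -> (K <= m)%N ->
  \sum_(j < 2 * m) theta_term y 1 m j = theta y 1 m.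
Proof.
move=> yK Km; rewrite /theta big_ord_recr /= [X in _ = _ + X](_ : _ = 0) ?addr0 //.
rewrite /theta_term (_ : 2 * m - m = m)%N; last by lia.
rewrite (nilp_ge yK) ?mul0r // (leq_trans Km) // binS bin1; lia.
Qed.

(** [phi x = U + x V] with all three series replaced by products.  The factor 2
    comes from [V = f (x ^ 8, 1)], whose product contains the factor [1 + 1]. *)
Lemma theta_product (R : comNzRingType) (x : R) K : x ^+ K = 0 ->
  poch (x ^+ 2) (4 * K) * (\prod_(i < 4 * K) (1 + x * (x ^+ 2) ^+ i)) ^+ 2 =
  poch (x ^+ 8) (2 * K) * ((\prod_(i < 2 * K) (1 + (x ^+ 2) ^+ (4 * i).+2)) ^+ 2
     + x *+ 2 * (\prod_(i < 2 * K) (1 + (x ^+ 2) ^+ (4 * i.+1))) ^+ 2).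
Proof.
move=> xK.
have xn n : (K <= n)%N -> x ^+ n = 0 := nilp_ge xK.
have XK n : (0 < n)%N -> (x ^+ n) ^+ K = 0.
  by move=> n0; rewrite -exprM xn // leq_pmull.
(* Truncated at indices at least [2 * K] in absolute value, a theta series has
   all terms of index beyond [K] equal to zero, so that the binomials that
   remain are at distance at least [K] from both ends of their row. *)
have := theta_dissect x (2 * K); rewrite (theta_odd_nilp (XK 8 isT)); last by lia.
rewrite -(@jacobi_triple_nilp _ x x K); first last.
- move=> j jK; rewrite theta_term_diag.
  have [|] := boolP ((K <= j) && (K <= 2 * (2 * (2 * K)) - j))%N; first by right.
  move=> h; left; apply: xn; nia.
- by rewrite -expr2 XK.
rewrite -(@jacobi_triple_nilp _ (x ^+ 4) (x ^+ 4) K); first last.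
- move=> j jK; rewrite theta_term_diag -exprM.
  have [|] := boolP ((K <= j) && (K <= 2 * (2 * K) - j))%N; first by right.
  move=> h; left; apply: xn; nia.
- by rewrite -exprD XK.
rewrite -(@jacobi_triple_nilp _ (x ^+ 8) 1 K); first last.
- move=> j jK; rewrite /theta_term expr1n mulr1 -exprM.
  have [|] := boolP ((K <= j) && (K <= 2 * (2 * K) - j))%N; first by right.
  move=> h; left; apply: xn.
  have [d [dK ->]] : exists d, (K < d)%N /\
      ('C((j - 2 * K).+1, 2) + 'C(2 * K - j, 2) = 'C(d, 2))%N.
    have [?|?] := leqP j (2 * K); [exists (2 * K - j)%N|exists (j - 2 * K).+1].
      by split; [lia|rewrite (_ : j - 2 * K = 0)%N //; lia].
    by split; [lia|rewrite (_ : 2 * K - j = 0)%N ?addn0 //; lia].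
  case: d dK => // d dK; rewrite binS bin1; lia.
- by rewrite mulr1 XK.
rewrite mulr1 -expr2 -exprD mulnA.
(* The first factor, [1 + 1], is taken out and a last one, equal to 1, added. *)
have -> : \prod_(i < 2 * K) (1 + 1 * x ^+ 8 ^+ i) =
   2 * \prod_(i < 2 * K) (1 + (x ^+ 2) ^+ (4 * i.+1)).
  transitivity (\prod_(i < (2 * K).+1) (1 + x ^+ 8 ^+ i)).
    rewrite big_ord_recr /= -exprM [x ^+ (8 * _)]xn ?addr0 ?mulr1; last by lia.
    by apply: eq_bigr => i _; rewrite mul1r.
  rewrite big_ord_recl expr0; congr (_ * _); apply: eq_bigr => i _.
  by rewrite lift0 -!exprM; congr (1 + x ^+ _); lia.
have -> : \prod_(i < 2 * K) (1 + x ^+ 8 * x ^+ 8 ^+ i) =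
   \prod_(i < 2 * K) (1 + (x ^+ 2) ^+ (4 * i.+1)).
  by apply: eq_bigr => i _; rewrite -!exprM -exprD; congr (1 + x ^+ _); lia.
have -> : \prod_(i < 2 * K) (1 + x ^+ 4 * x ^+ 8 ^+ i) =
   \prod_(i < 2 * K) (1 + (x ^+ 2) ^+ (4 * i).+2).
  by apply: eq_bigr => i _; rewrite -!exprM -exprD; congr (1 + x ^+ _); lia.
move=> E; rewrite expr2 mulrA E; ring.
Qed.

(** Multiply the instances of [theta_product] at [s] and [- s]: the right-hand
    sides are conjugate, so the product only involves [q = s ^ 2]. *)
Lemma theta_product_sqr (R : comNzRingType) (s q : R) K :
  s ^+ K = 0 -> q = s ^+ 2 ->
  (poch q (4 * K) * \prod_(i < 4 * K) (1 - q ^+ (2 * i).+1)) ^+ 2 =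
  poch (q ^+ 4) (2 * K) ^+ 2 *
  ((\prod_(i < 2 * K) (1 + q ^+ (4 * i).+2)) ^+ 4
   - q *+ 4 * (\prod_(i < 2 * K) (1 + q ^+ (4 * i.+1))) ^+ 4).
Proof.
move=> sK qE.
have nsK : (- s) ^+ K = 0 by rewrite exprNn sK mulr0.
have s8 : s ^+ 8 = q ^+ 4 by rewrite qE -exprM.
have ns8 : (- s) ^+ 8 = q ^+ 4 by rewrite (exprM _ 2 4) sqrrN -qE.
have := theta_product sK; have := theta_product nsK.
rewrite s8 ns8 sqrrN -qE.
have -> : \prod_(i < 4 * K) (1 - q ^+ (2 * i).+1) =
  (\prod_(i < 4 * K) (1 + s * q ^+ i)) * \prod_(i < 4 * K) (1 - s * q ^+ i).
  rewrite -big_split; apply: eq_bigr => i _ /=.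
  rewrite exprS mulnC exprM {1}qE; ring.
under [in X in X -> _]eq_bigr do rewrite mulNr.
move=> E1 E2.
transitivity ((poch q (4 * K) * (\prod_(i < 4 * K) (1 + s * q ^+ i)) ^+ 2) *
   (poch q (4 * K) * (\prod_(i < 4 * K) (1 - s * q ^+ i)) ^+ 2)); first by ring.
rewrite E1 E2 qE; ring.
Qed.

(** * * The identity between the generating functions *)

Definition gen_copies (R : comNzRingType) (m : nat -> nat) (q : R)
    (M : nat) : R :=
  \prod_(i < M) (1 + q ^+ i.+1) ^+ m i.+1.

Lemma gen_copies_dissect (R : comNzRingType) (q : R) (f : nat -> nat) a b c M :
  (forall n, f n = if odd n then a else if (4 %| n)%N then c else b) ->
  gen_copies f q (2 * (2 * M)) =
  (\prod_(i < 2 * M) (1 + q ^+ (2 * i).+1)) ^+ a *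
  ((\prod_(i < M) (1 + q ^+ (4 * i).+2)) ^+ b *
   (\prod_(i < M) (1 + q ^+ (4 * i.+1))) ^+ c).
Proof.
move=> fE.
rewrite /gen_copies (@prod_double _ (fun i => (1 + q ^+ i.+1) ^+ f i.+1)).
rewrite (@prod_double _ (fun i => (1 + q ^+ (2 * i).+2) ^+ f (2 * i).+2)).
rewrite -!prodrXl; congr (_ * (_ * _)); apply: eq_bigr => i _; rewrite fE.
- by rewrite ifT //; lia.
- rewrite ifN ?ifN; try lia.
  by congr ((1 + q ^+ _) ^+ _); lia.
- rewrite ifN ?ifT; try lia.
  by congr ((1 + q ^+ _) ^+ _); lia.
Qed.

(** With [E1], [E2] and [E4] the products of the [1 - q ^ n], [1 - q ^ (2 n)] and
    [1 - q ^ (4 n)], the factors [1 + q ^ n] carry [E1] to [E2], and the even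
    ones among them carry [E2] to [E4].  In particular the product of all the
    [1 + q ^ n] is inverse to the product [Oq] of the [1 - q ^ n] with [n] odd,
    which is Euler's theorem on odd and distinct parts. *)
Lemma gen_copies_ST (R : comNzRingType) (s q : R) K :
  s ^+ K = 0 -> q = s ^+ 2 ->
  gen_copies mult_S q (8 * K) = 1 + q *+ 4 * gen_copies mult_T q (8 * K).
Proof.
move=> sK qE.
have qn n : (0 < n)%N -> (q ^+ n) ^+ K = 0.
  by move=> n0; rewrite qE -!exprM (nilp_ge sK) //; nia.
have := theta_product_sqr sK qE.
rewrite (_ : 8 * K = 2 * (2 * (2 * K)))%N; last by lia.
rewrite (@gen_copies_dissect _ q mult_S 4 10 6) //.
rewrite (@gen_copies_dissect _ q mult_T 4 6 10) //.
rewrite (_ : 4 * K = 2 * (2 * K))%N; last by lia.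
set L := (2 * (2 * K))%N.
set Oq := \prod_(i < L) (1 - q ^+ (2 * i).+1).
set O := \prod_(i < L) (1 + q ^+ (2 * i).+1).
set B2 := \prod_(i < 2 * K) (1 + q ^+ (4 * i).+2).
set B4 := \prod_(i < 2 * K) (1 + q ^+ (4 * i.+1)).
set E1 := poch q L; set E4 := poch (q ^+ 4) (2 * K); pose E2 := poch (q ^+ 2) L.
move=> E.
have stq (p : R) : p ^+ K = 0 -> poch p (2 * L) = poch p L.
  by move=> pK; rewrite !(poch_stable pK) // /L; lia.
have e1 : E1 = Oq * E2.
  rewrite /E1 -stq ?(qn 1%N) // /poch (@prod_double _ (fun i => 1 - q ^+ i.+1)).
  congr (_ * _); apply: eq_bigr => i _; rewrite -exprM; congr (1 - q ^+ _); lia.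
have e2 : E2 * (B2 * B4) = E4.
  have -> : B2 * B4 = \prod_(i < L) (1 + (q ^+ 2) ^+ i.+1).
    rewrite (@prod_double _ (fun i => 1 + (q ^+ 2) ^+ i.+1)).
    by congr (_ * _); apply: eq_bigr => i _; rewrite -exprM; congr (1 + q ^+ _); lia.
  rewrite poch_prod1D -exprM /E4 !(poch_stable (qn 4 isT)) // /L; lia.
have e3 : E1 * (O * (B2 * B4)) = E2.
  have -> : O * (B2 * B4) = \prod_(i < 2 * L) (1 + q ^+ i.+1).
    rewrite (@prod_double _ (fun i => 1 + q ^+ i.+1)).
    rewrite (@prod_double _ (fun i => 1 + q ^+ (2 * i).+2)).
    by congr (_ * (_ * _)); apply: eq_bigr => i _; congr (1 + q ^+ _); lia.
  by rewrite /E1 -stq ?(qn 1%N) // poch_prod1D stq ?qn.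
have regE n L' : (0 < n)%N -> GRing.lreg (poch (q ^+ n) L').
  by move=> n0; apply: lreg_poch (qn n n0).
have e4 : O * (B2 * B4) * Oq = 1.
  by apply: (regE 2 L isT); rewrite -/E2 mulr1 -[RHS]e3 e1; ring.
(* It remains to see that [F_S - 4 q F_T] is 1, which is checked after
   multiplication by the regular element [E4 * E4]. *)
apply/eqP; rewrite -subr_eq; apply/eqP.
apply: (lregM (regE 4%N (2 * K)%N isT) (regE 4%N (2 * K)%N isT)).
rewrite -/E4 mulr1.
transitivity (E4 ^+ 2 * (B2 ^+ 4 - q *+ 4 * B4 ^+ 4) *
  (O ^+ 4 * (B2 * B4) ^+ 6)); first by ring.
rewrite -E.
transitivity ((E1 * (O * (B2 * B4))) ^+ 2 * (B2 * B4) ^+ 2 *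
  (O * (B2 * B4) * Oq) ^+ 2); first by ring.
rewrite e3 e4 -e2; ring.
Qed.

(** * * Counting partitions by coefficients *)

Lemma prod_1D_fpowerset (R : comNzRingType) (T : choiceType) (X : {fset T})
    (F : T -> R) :
  \prod_(x <- X) (1 + F x) = \sum_(A <- fpowerset X) \prod_(x <- A) F x.
Proof.
rewrite /fpowerset big_imfset /=; last first.
  by move=> A B _ _ /fsetP AB; apply/setP => x; have := AB (val x); rewrite !inE.
rewrite powersetT big_seq_fsetE /=.
under eq_bigr do rewrite addrC.
rewrite bigA_distr /= big_enum /=; apply: eq_big => [J|J _]; first by rewrite !inE.
rewrite -big_mkcond /= big_imfset /=; last by move=> x y _ _; apply: val_inj.
by rewrite big_enum.
Qed.

(** The variable of the generating function is the square of ['X], because the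
    identity between generating functions needs a square root of its variable.
    Any [M >= N] gives the same coefficient, as parts exceeding [N] occur in no
    partition of [N]. *)
Lemma coef_gen_copies (m : nat -> nat) (N M : nat) : (N <= M)%N ->
  (gen_copies m ('X^2 : {poly int}) M)`_(2 * N) = (D m N)%:R.
Proof.
move=> NM.
have -> : D m N =
    (\sum_(A <- fpowerset (copies_upto m M)) (\sum_(x <- A) x.1 == N))%N.
  rewrite /D (_ : distinct_partitions m N =
    [fset A in fpowerset (copies_upto m M) | (\sum_(x <- A) x.1 == N)%N]%fset).
    by rewrite card_fset_sum1 big_fset /= big_mkcond; apply: eq_bigr => A _; case: ifP.
  apply/fsetP => A; rewrite mem_distinct_partitions !inE /= fpowersetE /is_distinct_partition.
  apply/andP/andP => -[/=].
  - move=> /allP Am /eqP sumA; split; last by rewrite sumA.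
    apply/fsubsetP => x xA; rewrite mem_copies_upto Am //= (leq_trans _ NM) // -sumA.
    by rewrite (big_rem x) //= leq_addr.
  - move=> /fsubsetP Am sumA; split => //; apply/allP => x /Am.
    by rewrite mem_copies_upto => /andP[].
have -> : gen_copies m 'X^2 M =
   \prod_(x <- copies_upto m M) (1 + 'X^(2 * x.1)) :> {poly int}.
  rewrite /copies_upto (perm_big _ (seq_fset_perm _ _)) undup_id; last first.
    apply: allpairs_uniq_dep; rewrite ?iota_uniq //.
      by move=> n _; exact: iota_uniq.
    by move=> [x1 x2] [y1 y2] _ _ /= [-> ->].
  rewrite big_allpairs_dep /= -[1%N]addn0 iotaDl big_map.
  rewrite -[in RHS](subn0 M) -/(index_iota 0 M) big_mkord; apply: eq_bigr => i _.
  rewrite -exprM.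
  by rewrite big_const_seq count_predT size_iota -Monoid.iteropE add1n.
rewrite prod_1D_fpowerset coef_sum natr_sum; apply: eq_bigr => A _.
rewrite prodrXr coefXn -big_distrr /= eq_sym eqn_mul2l /=.
by case: eqP.
Qed.

Lemma eq_in_qpoly_coef (K : nat) (f g : {poly int}) (i : nat) : (i < K)%N ->
  in_qpoly 'X^K f = in_qpoly 'X^K g -> f`_i = g`_i.
Proof.
move=> iK /(congr1 val) /=; rewrite mk_monic_Xn.
case: K iK => // K iK /=.
have E := Pdiv.RingMonic.rdivp_eq (monicXn int K.+1).
move=> e; rewrite (E f) (E g) e !coefD; congr (_ + _).
by rewrite !coefMXn iK.
Qed.

Lemma gen_copies_rmorph (R1 R2 : comNzRingType) (f : {rmorphism R1 -> R2})
    (m : nat -> nat) (q : R1) (M : nat) :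
  f (gen_copies m q M) = gen_copies m (f q) M.
Proof.
rewrite /gen_copies rmorph_prod; apply: eq_bigr => i _.
by rewrite rmorphXn rmorphD rmorph1 rmorphXn.
Qed.

Local Close Scope ring_scope.

Theorem theorem3p12 (N : nat) (hN : 1 <= N) : D_S N = 4 * D_T (N - 1).
Proof.
pose K := (2 * N).+1.
pose s := in_qpoly 'X^K ('X : {poly int})%R.
have sK : (s ^+ K = 0)%R.
  rewrite -rmorphXn; apply: val_inj.
  by rewrite /= mk_monic_Xn /= Pdiv.RingMonic.rmodpp ?monicXn.
have := gen_copies_ST sK (erefl _); rewrite -rmorphXn -!gen_copies_rmorph.
rewrite -rmorphMn -rmorphM -(rmorph1 (in_qpoly 'X^K)) -rmorphD.
move/(@eq_in_qpoly_coef K _ _ (2 * N) (ltnSn _)).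
rewrite coef_gen_copies; last by rewrite /K; lia.
rewrite coefD coef1 mulrnAl coefMn coefXnM.
rewrite !ifN; try lia.
rewrite (_ : 2 * N - 2 = 2 * (N - 1)); last by lia.
rewrite coef_gen_copies; last by rewrite /K; lia.
by rewrite /D_S /D_T; lia.
Qed.
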